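(* Let $\Lambda$ be a hereditary QF-$3^{+}$ ring. The category $\Lambda\text{-}Mod_{St}$ of stable modules is Abelian and is closed in $\Lambda\text{-}Mod$ under essential extensions, and hence under injective envelopes. Moreover, the category $\Lambda\text{-}Mod_{St}$ has injective envelopes.
   Context: Rings are associative with identity; modules are left unital $\Lambda$-modules and $\Lambda\text{-}Mod$ is their category. A ring $\Lambda$ is left QF-$3^{+}$ if the injective envelope of the left module ${}_\Lambda\Lambda$ is projective; a left hereditary left QF-$3^{+}$ ring is also right hereditary and right QF-$3^{+}$, so one speaks of hereditary QF-$3^{+}$ rings. A module is stable if it has no nonzero projective direct summands; $\Lambda\text{-}Mod_{St}$ is the full subcategory of stable modules. *)

(* Defs.v *)
From HB Require Import structures.
From mathcomp Require Import all_boot all_algebra.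
From mathcomp Require Import boolp.

Set Implicit Arguments.
Unset Strict Implicit.
Unset Printing Implicit Defensive.

Import GRing.Theory.
Local Open Scope ring_scope.

(* A [pzRingType] is an associative ring with identity, possibly zero, and
   [lmodType R] is the type of unital left R-modules.  Decidable equality and
   choice on carriers are no restriction, classically (see [boolp]); for the
   same reason the boolean predicates in [submodClosed M] are all submodules. *)

Section HomGroup.
Variables (R : pzRingType) (M N : lmodType R).

Lemma linear_ext (f g : {linear M -> N}) : f =1 g -> f = g.
Proof.
case: f g => [f [[fA] [fB]]] [g [[gA] [gB]]] /= /funext fg.
by subst g; congr (GRing.Linear.Pack (GRing.Linear.Class _ _)); f_equal;
  apply: Prop_irrelevance.
Qed.

HB.instance Definition _ := gen_eqMixin {linear M -> N}.
HB.instance Definition _ := gen_choiceMixin {linear M -> N}.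

Definition linear_zero : {linear M -> N} := \0.
Definition linear_add (f g : {linear M -> N}) : {linear M -> N} := f \+ g.
Definition linear_opp (f : {linear M -> N}) : {linear M -> N} := \- f.

Lemma linear_addA : associative linear_add.
Proof. by move=> f g h; apply: linear_ext => x /=; rewrite addrA. Qed.
Lemma linear_addC : commutative linear_add.
Proof. by move=> f g; apply: linear_ext => x /=; rewrite addrC. Qed.
Lemma linear_add0 : left_id linear_zero linear_add.
Proof. by move=> f; apply: linear_ext => x /=; rewrite add0r. Qed.
Lemma linear_addN : left_inverse linear_zero linear_opp linear_add.
Proof. by move=> f; apply: linear_ext => x /=; rewrite addNr. Qed.

HB.instance Definition _ := GRing.isZmodule.Build {linear M -> N}
  linear_addA linear_addC linear_add0 linear_addN.

End HomGroup.

Record submodule_of (R : pzRingType) (M : lmodType R) (S : submodClosed M) :=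
  Submodule { submodule_val : M; _ : submodule_val \in S }.

Section SubmoduleStructure.
Variables (R : pzRingType) (M : lmodType R) (S : submodClosed M).
HB.instance Definition _ := [isSub for @submodule_val R M S].
HB.instance Definition _ := [Choice of submodule_of S by <:].
HB.instance Definition _ := [SubChoice_isSubLmodule of submodule_of S by <:].
End SubmoduleStructure.

Section Modules.
Variable R : pzRingType.
Implicit Types M N P E : lmodType R.

Definition projective P : Prop :=
  forall M N (g : {linear M -> N}) (f : {linear P -> N}),
    (forall y, exists x, g x = y) ->
    exists h : {linear P -> M}, forall x, g (h x) = f x.

Definition injective_module E : Prop :=
  forall M N (g : {linear M -> N}) (f : {linear M -> E}),
    injective g ->
    exists h : {linear N -> E}, forall x, h (g x) = f x.

Definition essential_extension M N (i : {linear M -> N}) : Prop :=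
  injective i /\
  forall S : submodClosed N,
    (exists2 y, y \in S & y != 0) ->
    exists2 x, i x \in S & i x != 0.

Definition injective_envelope M E (i : {linear M -> E}) : Prop :=
  essential_extension i /\ injective_module E.

Definition direct_summand M (S : submodClosed M) : Prop :=
  exists T : submodClosed M,
    (forall x, x \in S -> x \in T -> x = 0) /\
    (forall x, exists s t, [/\ s \in S, t \in T & x = s + t]).

Definition stable M : Prop :=
  forall S : submodClosed M,
    direct_summand S -> projective (submodule_of S) ->
    forall x, x \in S -> x = 0.

End Modules.

Definition left_hereditary (R : pzRingType) : Prop :=
  forall I : submodClosed R^o, projective (submodule_of I).

Definition left_QF3plus (R : pzRingType) : Prop :=
  exists (E : lmodType R) (i : {linear R^o -> E}),
    injective_envelope i /\ projective E.

(* The left-handed conditions suffice: a left hereditary left QF-3+ ring is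
   also right hereditary and right QF-3+. *)
Definition hereditary_QF3plus (R : pzRingType) : Prop :=
  left_hereditary R /\ left_QF3plus R.

Record preadditive_category := PreadditiveCategory {
  obj : Type;
  mor : obj -> obj -> zmodType;
  mor_id : forall A, mor A A;
  mor_comp : forall A B C, mor B C -> mor A B -> mor A C;
  compA : forall A B C D (h : mor C D) (g : mor B C) (f : mor A B),
    mor_comp h (mor_comp g f) = mor_comp (mor_comp h g) f;
  comp1m : forall A B (f : mor A B), mor_comp (mor_id B) f = f;
  compm1 : forall A B (f : mor A B), mor_comp f (mor_id A) = f;
  compDl : forall A B C (g g' : mor B C) (f : mor A B),
    mor_comp (g + g') f = mor_comp g f + mor_comp g' f;
  compDr : forall A B C (g : mor B C) (f f' : mor A B),
    mor_comp g (f + f') = mor_comp g f + mor_comp g f'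
}.

Section Categories.
Variable C : preadditive_category.
Implicit Types A B X Z K Q : obj C.

Definition monic A B (f : mor A B) : Prop :=
  forall X (g h : mor X A), mor_comp f g = mor_comp f h -> g = h.

Definition epic A B (f : mor A B) : Prop :=
  forall X (g h : mor B X), mor_comp g f = mor_comp h f -> g = h.

(* Every group of morphisms contains 0, so this says that Z is initial and
   terminal. *)
Definition zero_object Z : Prop :=
  forall X, (forall f : mor Z X, f = 0) /\ (forall f : mor X Z, f = 0).

Definition is_biproduct A B X (iA : mor A X) (iB : mor B X)
    (pA : mor X A) (pB : mor X B) : Prop :=
  [/\ mor_comp pA iA = mor_id A, mor_comp pB iB = mor_id B,
      mor_comp pA iB = 0, mor_comp pB iA = 0
    & mor_comp iA pA + mor_comp iB pB = mor_id X].

Definition is_kernel A B K (f : mor A B) (k : mor K A) : Prop :=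
  mor_comp f k = 0 /\
  forall X (g : mor X A), mor_comp f g = 0 ->
    exists! h : mor X K, mor_comp k h = g.

Definition is_cokernel A B Q (f : mor A B) (q : mor B Q) : Prop :=
  mor_comp q f = 0 /\
  forall X (g : mor B X), mor_comp g f = 0 ->
    exists! h : mor Q X, mor_comp h q = g.

Definition additive_category : Prop :=
  (exists Z, zero_object Z) /\
  (forall A B, exists X (iA : mor A X) (iB : mor B X)
     (pA : mor X A) (pB : mor X B), is_biproduct iA iB pA pB).

Definition abelian_category : Prop :=
  [/\ additive_category,
      forall A B (f : mor A B), exists K (k : mor K A), is_kernel f k,
      forall A B (f : mor A B), exists Q (q : mor B Q), is_cokernel f q,
      forall A B (f : mor A B), monic f ->
        exists X (g : mor B X), is_kernel g f
    & forall A B (f : mor A B), epic f ->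
        exists X (g : mor X A), is_cokernel g f].

Definition injective_object (E : obj C) : Prop :=
  forall A B (g : mor A B) (f : mor A E), monic g ->
    exists h : mor B E, mor_comp h g = f.

Definition essential_mono A B (i : mor A B) : Prop :=
  monic i /\ forall X (g : mor B X), monic (mor_comp g i) -> monic g.

Definition has_injective_envelopes : Prop :=
  forall A, exists (E : obj C) (i : mor A E),
    essential_mono i /\ injective_object E.

End Categories.

Definition full_subcategory (C : preadditive_category) (P : obj C -> Prop) :
    preadditive_category :=
  @PreadditiveCategory {A : obj C | P A}
    (fun A B => mor (sval A) (sval B))
    (fun A => mor_id (sval A))
    (fun A B D g f => mor_comp g f)
    (fun _ _ _ _ h g f => compA h g f)
    (fun _ _ f => comp1m f)
    (fun _ _ f => compm1 f)
    (fun _ _ _ g g' f => compDl g g' f)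
    (fun _ _ _ g f f' => compDr g f f').

Section ModuleCategory.
Variable R : pzRingType.

Definition linear_id (M : lmodType R) : {linear M -> M} := idfun.

Definition linear_comp (M N P : lmodType R)
    (g : {linear N -> P}) (f : {linear M -> N}) : {linear M -> P} := g \o f.

Lemma linear_compA (M N P Q : lmodType R) (h : {linear P -> Q})
    (g : {linear N -> P}) (f : {linear M -> N}) :
  linear_comp h (linear_comp g f) = linear_comp (linear_comp h g) f.
Proof. exact: linear_ext. Qed.

Lemma linear_comp1m (M N : lmodType R) (f : {linear M -> N}) :
  linear_comp (linear_id N) f = f.
Proof. exact: linear_ext. Qed.

Lemma linear_compm1 (M N : lmodType R) (f : {linear M -> N}) :
  linear_comp f (linear_id M) = f.
Proof. exact: linear_ext. Qed.

Lemma linear_compDl (M N P : lmodType R) (g g' : {linear N -> P})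
    (f : {linear M -> N}) :
  linear_comp (g + g') f = linear_comp g f + linear_comp g' f.
Proof. exact: linear_ext. Qed.

Lemma linear_compDr (M N P : lmodType R) (g : {linear N -> P})
    (f f' : {linear M -> N}) :
  linear_comp g (f + f') = linear_comp g f + linear_comp g f'.
Proof. by apply: linear_ext => x /=; rewrite raddfD. Qed.

Definition module_category : preadditive_category :=
  @PreadditiveCategory (lmodType R)
    (fun M N => {linear M -> N} : zmodType)
    linear_id linear_comp linear_compA linear_comp1m linear_compm1
    linear_compDl linear_compDr.

Definition stable_category : preadditive_category :=
  @full_subcategory module_category (@stable R).

End ModuleCategory.

(* Main.v *)
(* Over a left hereditary ring the image of a map M -> R is projective, hence a
   direct summand of M; so M is stable iff Hom(M, R) = 0.  If moreover the
   injective envelope E of R is projective, hence cogenerated by R, this is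
   equivalent to Hom(M, E) = 0, so the stable modules are the torsion class of
   a hereditary torsion theory: they are closed under submodules, quotients and
   finite products, which makes them an abelian category.  If M is stable and
   essential in N, a map N -> R kills M, and a complement of its kernel meets M
   trivially, hence is zero; so N is stable.
     For the existence of injective envelopes, write M as F / K with F free.
   Then F embeds in a power E^M, and M in E^M / K, which is injective because
   over a hereditary ring quotients of injectives are injective.  For the same
   reason, if M embeds in an injective Q and T is a submodule of Q maximal with
   T meeting M trivially, then Q / T is an injective envelope of M. *)

From HB Require Import structures.
Require Import Defs.
From mathcomp Require Import all_boot all_algebra.
From mathcomp Require Import boolp classical_sets functions.

Set Implicit Arguments.
Unset Strict Implicit.
Unset Printing Implicit Defensive.

Import GRing.Theory.
Local Open Scope classical_set_scope.
Local Open Scope ring_scope.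

(** * Constructing linear maps from functions, relations and factorisations *)

Section LinearMaps.
Variable R : pzRingType.
Implicit Types M N P : lmodType R.

Lemma linear_exists M N (f : M -> N) :
  linear f -> exists g : {linear M -> N}, g =1 f.
Proof.
move=> lf.
pose g : {linear M -> N} := HB.pack f (GRing.isLinear.Build R M N *:%R f lf).
by exists g.
Qed.

(** Two values at one point differ by a value at 0, so single-valuedness has to be tested only
    there. *)
Lemma linear_of_graph M N (G : M -> N -> Prop) :
  (forall x, exists y, G x y) -> (forall y, G 0 y -> y = 0) ->
  (forall a x x' y y', G x y -> G x' y' -> G (a *: x + x') (a *: y + y')) ->
  exists h : {linear M -> N}, forall x, G x (h x).
Proof.
move=> /choice[h Gh] G0 GL.
have Guniq x y y' : G x y -> G x y' -> y = y'.
  move=> Gy Gy'; apply/esym/eqP; rewrite -subr_eq0 addrC -scaleN1r; apply/eqP/G0.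
  by rewrite -[X in G X _](addNr x) -scaleN1r; apply: GL.
have [|g gh] := @linear_exists M N h; last by exists g => x; rewrite gh.
by move=> a x y; apply: Guniq (Gh _) _; apply: GL.
Qed.

Lemma linear_factor M N P (q : {linear M -> N}) (g : {linear M -> P}) :
  (forall y, exists x, q x = y) -> (forall x, q x = 0 -> g x = 0) ->
  exists h : {linear N -> P}, forall x, h (q x) = g x.
Proof.
move=> qS qg.
have [||a _ _ _ _ [x [<- <-]] [x' [<- <-]]|h hP] :=
    @linear_of_graph N P (fun y z => exists x, q x = y /\ g x = z).
- by move=> y; have [x <-] := qS y; exists (g x), x.
- by move=> z [x [/qg gx0 <-]].
- by exists (a *: x + x'); rewrite !linearP.
exists h => x; have [x' [/eqP]] := hP (q x).
by rewrite -subr_eq0 -raddfB => /eqP/qg/eqP; rewrite raddfB subr_eq0 => /eqP ->.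
Qed.

Lemma linear_lift M N P (k : {linear N -> P}) (g : {linear M -> P}) :
  injective k -> (forall x, exists y, k y = g x) ->
  exists h : {linear M -> N}, forall x, k (h x) = g x.
Proof.
move=> kI gk; apply: linear_of_graph gk _ _ => [y|a x x' y y' e e'].
  by rewrite linear0 -[RHS](linear0 k); apply: kI.
by rewrite !linearP e e'.
Qed.

Lemma linear_inj M N (f : {linear M -> N}) :
  (forall x, f x = 0 -> x = 0) -> injective f.
Proof.
move=> f0 x y /eqP; rewrite -subr_eq0 -raddfB => /eqP/f0/eqP.
by rewrite subr_eq0 => /eqP.
Qed.

Lemma linear_inj0 M N (f : {linear M -> N}) x :
  injective f -> f x = 0 -> x = 0.
Proof. by move=> fI; rewrite -(linear0 f) => /fI. Qed.

End LinearMaps.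

(** * Submodules given by propositional predicates; kernels and images *)

Section Submodules.
Variable R : pzRingType.
Implicit Types M N : lmodType R.

Definition submod_set M (A : set M) : Prop :=
  A 0 /\ forall a x y, A x -> A y -> A (a *: x + y).

Lemma submod_of_set M (A : set M) : submod_set A ->
  exists S : submodClosed M, forall x, x \in S <-> A x.
Proof.
move=> [A0 AL]; pose f x := `[< A x >].
have AP x : (x \in f) <-> A x by split=> /asboolP.
have fL : GRing.subsemimod_closed f.
  split; first split; first exact/AP.
  - by move=> x y /AP Ax /AP Ay; apply/AP; rewrite -[x]scale1r; apply: AL.
  - by move=> a x /AP Ax; apply/AP; rewrite -[_ *: _]addr0; apply: AL.
pose S : submodClosed M := HB.pack f (GRing.isSubmodClosed.Build R M f fL).
by exists S.
Qed.

Lemma submod_set_bigcup M (F : set (set M)) :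
  F !=set0 -> (forall A, F A -> submod_set A) -> total_on F subset ->
  submod_set (\bigcup_(A in F) A).
Proof.
move=> [A0 FA0] FS Ftot; split; first by exists A0 => //; have [] := FS _ FA0.
move=> a x y [A FA Ax] [B FB By].
have [AB|BA] := Ftot _ _ FA FB.
  by exists B => //; have [_] := FS _ FB; apply=> //; apply: AB.
by exists A => //; have [_] := FS _ FA; apply=> //; apply: BA.
Qed.

Lemma ker_submod M N (f : {linear M -> N}) :
  exists S : submodClosed M, forall x, x \in S <-> f x = 0.
Proof.
apply: submod_of_set; split=> [|a x y /= fx fy]; first exact: linear0.
by rewrite linearP fx fy scaler0 addr0.
Qed.

Lemma image_submod M N (f : {linear M -> N}) :
  exists S : submodClosed N, forall y, y \in S <-> exists x, f x = y.
Proof.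
apply: submod_of_set; split=> [|a _ _ [x <-] [y <-]].
  by exists 0; rewrite linear0.
by exists (a *: x + y); rewrite linearP.
Qed.

Lemma submodule_valI M (S : submodClosed M) : injective (\val : submodule_of S -> M).
Proof. exact: val_inj. Qed.

Lemma corestrict M N (f : {linear M -> N}) (S : submodClosed N) :
  (forall x, f x \in S) ->
  exists g : {linear M -> submodule_of S}, forall x, \val (g x) = f x.
Proof.
move=> fS; apply: linear_lift (@submodule_valI _ _) _ => x.
by exists (Submodule (fS x)).
Qed.

(** For a functional [M -> R^o] the image is a left ideal, hence projective over a left hereditary
    ring, so that [g] splits. *)
Lemma linear_image M N (f : {linear M -> N}) :
  exists (S : submodClosed N) (g : {linear M -> submodule_of S}),
    (forall y, exists x, g x = y) /\ (forall x, \val (g x) = f x).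
Proof.
have [S SP] := image_submod f.
have [x|g gE] := @corestrict _ _ f S; first by apply/SP; exists x.
exists S, g; split=> // y; have /SP[x fx] := valP y.
by exists x; apply: val_inj; rewrite gE.
Qed.

End Submodules.

(** * Quotient modules *)

Section QuotientModule.
Variables (R : pzRingType) (M : lmodType R) (S : submodClosed M).
Local Open Scope quotient_scope.

(** The quotient is first taken as an abelian group, so [S] is repackaged as an additive subgroup.
    Scalars then act through chosen representatives, and [piZ] gives independence of the choice. *)
Let inS x := x \in S.
Let Z : zmodClosed M := HB.pack inS (GRing.isZmodClosed.Build M inS
  (GRing.subsemimod_closedB (GRing.subsemimodClosedP S))).

Definition quotient_module : Type := Quotient.quot Z.
HB.instance Definition _ := GRing.Zmodule.on quotient_module.

Let pi : M -> quotient_module := \pi_(Quotient.quot Z).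

Let pi_eq x y : pi x = pi y <-> x - y \in S.
Proof.
rewrite -[_ \in S]/(_ \in Z) Quotient.idealrBE.
by split=> /eqP.
Qed.

Let piD : {morph pi : x y / x + y}.
Proof. exact: raddfD. Qed.

Let pi_surj (y : quotient_module) : exists x, pi x = y.
Proof. by exists (repr (y : Quotient.quot _)); rewrite /pi reprK. Qed.

Let scale (a : R) (y : quotient_module) : quotient_module :=
  pi (a *: sval (cid (pi_surj y))).

Let piZ a x : pi (a *: x) = scale a (pi x).
Proof.
rewrite /scale; case: cid => z /= /pi_eq zx; apply/pi_eq.
by rewrite -scalerBr -opprB -scaleN1r !rpredZ.
Qed.

Let scaleA a b y : scale a (scale b y) = scale (a * b) y.
Proof. by have [x <-] := pi_surj y; rewrite -!piZ scalerA. Qed.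

Let scale1 : left_id 1 scale.
Proof. by move=> y; have [x <-] := pi_surj y; rewrite -!piZ scale1r. Qed.

Let scaleDr : right_distributive scale +%R.
Proof.
move=> a y z; have [x <-] := pi_surj y; have [x' <-] := pi_surj z.
by rewrite -[pi x + _]piD -!piZ -piD scalerDr.
Qed.

Let scaleDl y : {morph scale^~ y : a b / a + b}.
Proof.
by move=> a b; have [x <-] := pi_surj y; rewrite -!piZ -piD scalerDl.
Qed.

HB.instance Definition _ := GRing.Zmodule_isLmodule.Build R quotient_module
  scaleA scale1 scaleDr scaleDl.

Lemma quotient_exists : exists (Q : lmodType R) (q : {linear M -> Q}),
  (forall y, exists x, q x = y) /\ (forall x, q x = 0 <-> x \in S).
Proof.
have [|q qE] := @linear_exists R M quotient_module pi.
  by move=> a x y; rewrite piD piZ.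
exists quotient_module, q; split=> [y|x]; first by have [x <-] := pi_surj y; exists x.
by rewrite -(linear0 q) !qE pi_eq subr0.
Qed.

End QuotientModule.

(** * Baer's criterion, free covers, and injective envelopes of modules *)

Section Injectivity.
Variable R : pzRingType.
Implicit Types M N P E : lmodType R.

(** The empty set may fail [P]. Applying Zorn's lemma to the sets whose union with [A0] satisfies
    [P] makes the empty chain stand for [A0]. *)
Lemma Zorn_nonempty (T : Type) (P : set (set T)) (A0 : set T) : P A0 ->
  (forall F, F !=set0 -> (F `<=` P) -> total_on F subset ->
     P (\bigcup_(A in F) A)) ->
  exists A, P A /\ forall B, (A `<=` B) -> P B -> (B `<=` A).
Proof.
move=> PA0 Pchain; pose P' A := P (A0 `|` A).
have [F FP Ftot|A [PA maxA]] := @Zorn_bigcup _ P'.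
  have [F0|/nonemptyPn->] := pselect (F !=set0); last first.
    by rewrite /P' bigcup_set0 setU0.
  rewrite /P'; have -> : (A0 `|` \bigcup_(A in F) A =
      \bigcup_(B in [set A0 `|` A | A in F]) B).
    rewrite bigcup_image; apply/seteqP; split=> x.
      case=> [A0x|[A FA Ax]]; last by exists A => //; right.
      by have [A FA] := F0; exists A => //; left.
    by case=> A FA [A0x|Ax]; [left|right; exists A].
  apply: Pchain => [|_ [A FA <-]|_ _ [A FA <-] [B FB <-]].
  - by have [A FA] := F0; exists (A0 `|` A), A.
  - exact: FP.
  - by have [AB|BA] := Ftot _ _ FA FB; [left|right]; apply: setUS.
exists (A0 `|` A); split=> // B AB PB; apply: contrapT => nBA.
apply: (maxA B); last by rewrite /P' setUidr // => x A0x; apply: AB; left.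
split; first by move=> x Ax; apply: AB; right.
by move=> BA; apply: nBA => x /BA; right.
Qed.

(** Baer's criterion. Take a maximal partial extension of [f] along [g]. For any [y], the hypothesis
    supplies a value at [y] compatible with those on the multiples of [y] in the domain, so by
    maximality [y] is in the domain already. *)
Lemma baer_injective E :
  (forall (I : submodClosed R^o) (f : {linear submodule_of I -> E}),
     exists e : E, forall r, f r = (\val r : R) *: e) ->
  injective_module E.
Proof.
move=> baerE M N g f gI.
pose graph := [set z : N * E | exists x, z = (g x, f x)].
(* These are the graphs of partial linear maps extending [f] along [g]; by linearity the condition
   over 0 expresses single-valuedness. *)
pose P (G : set (N * E)) := [/\ submod_set G, (graph `<=` G)
  & forall e, G (0, e) -> e = 0].
have [|F F0 FP Ftot|G [[[G0 GL] graphG Gfun] Gmax]] := @Zorn_nonempty _ P graph.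
- split=> // [|e [x [/esym gx0 ->]]].
  + split=> [|a _ _ [x ->] [y ->]]; first by exists 0; rewrite !linear0.
    by exists (a *: x + y); rewrite !linearP.
  + by rewrite (linear_inj0 gI gx0) linear0.
- split=> [|z gz|e [A FA Ae]]; last by have [_ _] := FP _ FA; apply.
  + by apply: submod_set_bigcup => // A /FP[].
  + by have [A FA] := F0; exists A => //; have [_ + _] := FP _ FA; apply.
have Gneg x e : G (x, e) -> G (- x, - e).
  by move=> Gx; have := GL (-1) _ _ Gx G0; rewrite addr0 scaleN1r.
have Guniq x e e' : G (x, e) -> G (x, e') -> e = e'.
  move=> Ge /Gneg Ge'; apply/eqP; rewrite -subr_eq0; apply/eqP/Gfun.
  by have := GL 1 _ _ Ge Ge'; rewrite scale1r /GRing.add /= /add_pair /= subrr.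
suff Gdom y : exists e, G (y, e).
  have [||a x x' e e' Ge Ge'|h Gh] := @linear_of_graph R N E (fun y e => G (y, e)).
  - exact: Gdom.
  - exact: Gfun.
  - exact: (GL a _ _ Ge Ge').
  by exists h => x; apply: Guniq (Gh _) _; apply: graphG; exists x.
(* [I] consists of the [r] with [r *: y] in the domain of [G], and [h] below sends [r] to the value
   there; [e0] is then the candidate value at [y]. *)
have [|I IP] := @submod_of_set R R^o [set r : R | exists e, G (r *: y, e)].
  split=> [|a r s [e Ge] [e' Ge']]; first by exists 0; rewrite scale0r.
  exists (a *: e + e'); rewrite scalerDl -scalerA; exact: GL Ge Ge'.
have [r|e|a r s e e' Ge Ge'|h Gh] :=
    @linear_of_graph R (submodule_of I) E (fun r e => G ((\val r : R) *: y, e)).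
- exact/IP/valP.
- by rewrite linear0 scale0r; apply: Gfun.
- by rewrite linearP scalerDl -scalerA; exact: GL Ge Ge'.
have [e0 he0] := baerE I h.
pose G' := [set z : N * E | exists r x e,
  G (x, e) /\ z = (x + r *: y, e + r *: e0)].
exists e0; apply: (Gmax G'); last 1 first.
- by exists 1, 0, 0; rewrite !scale1r !add0r.
- by move=> [x e] Ge; exists 0, x, e; rewrite !scale0r !addr0.
split=> [|z /graphG|e [r [x [e' [Ge' [/esym/eqP]]]]]].
- split=> [|a _ _ [r [x [e [Ge ->]]]] [r' [x' [e' [Ge' ->]]]]].
    by exists 0, 0, 0; rewrite !scale0r !addr0.
  exists (a * r + r'), (a *: x + x'), (a *: e + e'); split; first exact: GL Ge Ge'.
  by congr (_, _); rewrite /= scalerDl -scalerA scalerDr addrACA.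
- by case: z => x e Ge; exists 0, x, e; rewrite !scale0r !addr0.
(* Over 0 one has [x = - (r *: y)], so [r] lies in [I] and the value [- e'] of [G] at [r *: y] must
   be [r *: e0]; the sum [e' + r *: e0] cancels. *)
rewrite addr_eq0 => /eqP xE ->; have := Gneg _ _ Ge'; rewrite xE opprK => Gr.
have rI : r \in I by apply/IP; exists (- e').
have /(Guniq _ _ _ Gr) := Gh (Submodule rI : submodule_of I).
by rewrite he0 /= => <-; rewrite addrN.
Qed.

Lemma injective_fun (X : Type) E :
  injective_module E -> injective_module (X -> E : lmodType R).
Proof.
move=> Einj M N g f gI.
have /choice[h hE] x : exists h : {linear N -> E}, forall y, h (g y) = f y x.
  have [|fx fxE] := @linear_exists R M E (fun y => f y x).
    by move=> a y z; rewrite linearP.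
  by have [h hE] := Einj _ _ g fx gI; exists h => y; rewrite hE.
have [|H HE] := @linear_exists R N (X -> E : lmodType R) (fun y x => h x y).
  by move=> a y z; apply/funext => x; rewrite linearP.
by exists H => y; rewrite HE; apply/funext => x.
Qed.

(** By Baer's criterion only maps from left ideals matter. Such an ideal is projective, so the map
    lifts to [E], extends to [R], and the image of 1 gives the required element. *)
Lemma injective_quotient E P (q : {linear E -> P}) : left_hereditary R ->
  (forall y, exists x, q x = y) -> injective_module E -> injective_module P.
Proof.
move=> hR qS Einj; apply: baer_injective => I f.
have [f' f'E] := hR I _ _ q f qS.
have [h hE] := Einj _ _ (\val : {linear submodule_of I -> R^o}) f' val_inj.
exists (q (h 1)) => r; rewrite -f'E -hE -!linearZ; congr (q (h _)).
by rewrite /GRing.scale /= mulr1.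
Qed.

(** The free module on the set [M] is realised as the span of the functions [delta m]. Formal
    combinations are lists of pairs: [comb] reads a list as a function, [value] evaluates it in
    [M]. *)
Lemma free_cover M : exists (F : lmodType R)
    (j : {linear F -> (M -> R^o : lmodType R)}) (p : {linear F -> M}),
  injective j /\ forall y, exists x, p x = y.
Proof.
pose delta (m : M) : M -> R^o := fun n => (m == n)%:R.
pose comb (s : seq (R * M)) : M -> R^o := \sum_(z <- s) z.1 *: delta z.2.
pose value (s : seq (R * M)) : M := \sum_(z <- s) z.1 *: z.2.
pose addZ a (s t : seq (R * M)) := [seq (a * z.1, z.2) | z <- s] ++ t.
have combP a s t : comb (addZ a s t) = a *: comb s + comb t.
  rewrite /comb big_cat big_map scaler_sumr; congr (_ + _).
  by apply: eq_bigr => z _; rewrite scalerA.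
have valueP a s t : value (addZ a s t) = a *: value s + value t.
  rewrite /value big_cat big_map scaler_sumr; congr (_ + _).
  by apply: eq_bigr => z _; rewrite scalerA.
(* This makes [p] well defined. Grouping the terms of [value s] by their element [n] produces the
   coefficient [comb s n]. *)
have comb0 s : comb s = 0 -> value s = 0.
  move=> s0; transitivity (\sum_(n <- undup (map snd s)) (comb s n : R) *: n).
    transitivity (\sum_(z <- s) \sum_(n <- undup (map snd s))
        (z.1 * (z.2 == n)%:R) *: n).
      apply: eq_big_seq => z zs.
      rewrite (bigD1_seq z.2) ?undup_uniq ?mem_undup ?map_f //= eqxx mulr1.
      by rewrite big1 ?addr0 // => n /negPf nz; rewrite eq_sym nz mulr0 scale0r.
    rewrite exchange_big; apply: eq_bigr => n _.
    by rewrite /comb fct_sumE -scaler_suml.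
  by rewrite s0 big1 // => n _; rewrite scale0r.
have [|S SP] := @submod_of_set R (M -> R^o : lmodType R)
    [set x | exists s, x = comb s].
  split=> [|a _ _ [s ->] [t ->]]; first by exists [::]; rewrite /comb big_nil.
  by exists (addZ a s t).
have [x|m [s [/esym/comb0 s0 ->]]|a x x' m m' [s [xs ->]] [t [xt ->]]|p pP] :=
  @linear_of_graph R (submodule_of S) M
    (fun x m => exists s, \val x = comb s /\ m = value s).
- by have /SP[s xs] := valP x; exists (value s), s.
- exact: s0.
- by exists (addZ a s t); rewrite combP -xs -xt linearP valueP.
exists (submodule_of S), \val, p; split=> [|m]; first exact: val_inj.
have mS : comb [:: (1, m)] \in S by apply/SP; exists [:: (1, m)].
exists (Submodule mS); have [s [/= sE ->]] := pP (Submodule mS).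
(* The list [s] representing [delta m] may differ from [[:: (1, m)]], but their difference has zero
   [comb], hence zero [value]. *)
have : comb (addZ (-1) s [:: (1, m)]) = 0 by rewrite combP -sE scaleN1r addNr.
move/comb0; rewrite valueP scaleN1r {2}/value big_seq1 scale1r addrC.
by move/eqP; rewrite subr_eq0 => /eqP.
Qed.

(** A section of the free cover embeds [P] in a power of [R], where some coordinate of the image of
    [x] is nonzero. *)
Lemma projective_torsionless P (x : P) : projective P -> x != 0 ->
  exists f : {linear P -> R^o}, f x != 0.
Proof.
move=> Pproj x0; have [F [j [p [jI pS]]]] := free_cover P.
have [h hE] := Pproj _ _ p idfun pS.
have [[n jn]|nz] := pselect (exists n, j (h x) n != 0).
  have [|f fE] := @linear_exists R P R^o (fun y => j (h y) n).
    by move=> a y z; rewrite !linearP.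
  by exists f; rewrite fE.
case/eqP: x0; rewrite -[x]/(idfun x) -hE.
rewrite (_ : h x = 0) ?linear0 //; apply: (linear_inj0 jI); apply/funext => n.
by apply/eqP; apply: contrapT => jn; apply: nz; exists n; apply/negP.
Qed.

Lemma injective_embedding M : hereditary_QF3plus R ->
  exists (E : lmodType R) (i : {linear M -> E}),
    injective i /\ injective_module E.
Proof.
move=> [hR [E [i [[[iI _] Einj] _]]]].
have [F [j [p [jI pS]]]] := free_cover M.
have [|k kE] := @linear_exists R F (M -> E : lmodType R) (fun x n => i (j x n)).
  by move=> a x y; apply/funext => n; rewrite !linearP.
have kI : injective k.
  move=> x y; rewrite !kE => xy; apply: jI; apply/funext => n; apply: iI.
  exact: (congr1 (fun f : M -> E => f n) xy).
(* [S] is the copy of the kernel of [p] in [M -> E]; modulo [S], the map [k] descends to [M],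
   injectively because [k] is injective. *)
have [|S SP] := @submod_of_set R (M -> E : lmodType R)
    [set y | exists2 x, p x = 0 & y = k x].
  split=> [|a _ _ [x px ->] [y py ->]]; first by exists 0; rewrite !linear0.
  by exists (a *: x + y); rewrite linearP ?px ?py ?scaler0 ?addr0.
have [Q [q [qS qP]]] := quotient_exists S.
have [x px|h hE] := @linear_factor R F M Q p (q \o k) pS.
  by apply/qP/SP; exists x.
exists Q, h; split; last exact: injective_quotient (injective_fun (X := M) Einj).
apply: linear_inj => y; have [x <-] := pS y.
by rewrite hE => /qP/SP[x' px' /kI ->].
Qed.

Lemma injective_envelope_exists M : hereditary_QF3plus R ->
  exists (E : lmodType R) (i : {linear M -> E}), injective_envelope i.
Proof.
move=> hR; have [Q [k [kI Qinj]]] := injective_embedding M hR.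
pose P (A : set Q) := submod_set A /\ forall x, A (k x) -> x = 0.
have [|F F0 FP Ftot|A [[Asub Ak] Amax]] := @Zorn_nonempty _ P [set 0].
- split=> [|x /(linear_inj0 kI)//]; split=> // a _ _ -> ->.
  by rewrite /= scaler0 addr0.
- split=> [|x [A FA Ax]]; last by have [_] := FP _ FA; apply.
  by apply: submod_set_bigcup => // A /FP[].
have [S SP] := submod_of_set Asub.
have [E [q [qS qP]]] := quotient_exists S.
exists E, (q \o k); split; last exact: injective_quotient hR.1 qS Qinj.
split; first by apply: linear_inj => x /qP/SP/Ak.
move=> U [y yU y0]; apply: contrapT => nU.
have [x xE] := qS y; case/eqP: y0; rewrite -xE; apply/qP/SP.
(* If [U] meets the image of [M] trivially, its preimage in [Q] contains [A] and still meets [M]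
   trivially. Maximality puts [x] in [A], against [y != 0]. *)
apply: (Amax [set z | q z \in U]) => [z /SP/qP /= ->||]; last first.
- by rewrite /= xE.
- split=> [|z /= zU]; last first.
    apply/eqP; apply: contrapT => /negP z0; apply: nU; exists z => //.
    by apply: contraNneq z0 => /qP/SP/Ak ->.
  split=> [|a u v /= uU vU]; first by rewrite /= linear0 rpred0.
  by rewrite linearP rpredD ?rpredZ.
- exact: rpred0.
Qed.

End Injectivity.

(** * Stability as the vanishing of functionals, and closure properties *)

Section StableModules.
Variable R : pzRingType.
Implicit Types M N P E : lmodType R.

Lemma projective_retract P N (p : {linear P -> N}) (s : {linear N -> P}) :
  (forall x, p (s x) = x) -> projective P -> projective N.
Proof.
move=> ps Pproj M Q g f gS; have [h hE] := Pproj _ _ g (f \o p) gS.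
by exists (h \o s) => x; rewrite /comp hE /= ps.
Qed.

(** The image [I] of [f] is projective, so [M -> I] has a section [h], whose image [S] is a direct
    summand of [M] isomorphic to [I]. Stability kills [S], hence [f]. *)
Lemma stable_hom0 M (f : {linear M -> R^o}) x :
  left_hereditary R -> stable M -> f x = 0.
Proof.
move=> hR Mst; have [I [g [gS gE]]] := linear_image f.
have [h hE] := hR I _ _ g idfun gS.
have [S [h' [h'S h'E]]] := linear_image h.
have [K KP] := ker_submod g.
have hS y : h y \in S by rewrite -h'E; apply: valP.
suff hgx0 : h (g x) = 0 by rewrite -gE -[g x]/(idfun (g x)) -hE hgx0 !linear0.
apply: (Mst S _ _ _ (hS _)); last first.
  apply: (@projective_retract _ _ h' (g \o \val)) (hR I) => z.
  by have [y <-] := h'S z; rewrite /= h'E hE.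
exists K; split=> [z zS /KP gz|z].
  have [y yE] := h'S (Submodule zS); have : z = h y by rewrite -h'E yE.
  by move=> zE; move: gz; rewrite zE hE /= => ->; rewrite linear0.
exists (h (g z)), (z - h (g z)); split; rewrite ?hS //; last by rewrite addrC subrK.
by apply/KP; rewrite linearB hE subrr.
Qed.

(** A nonzero element of a projective summand is detected by a functional on it, which the
    projection extends to [M]. *)
Lemma hom0_stable M :
  (forall (f : {linear M -> R^o}) x, f x = 0) -> stable M.
Proof.
move=> f0 S [T [ST MST]] Sproj x xS.
(* [p] is the projection onto [S] along [T]. *)
have [y|y|a y y' z z' Tz Tz'|p pT] :=
    @linear_of_graph R M (submodule_of S) (fun y z => y - \val z \in T).
- have [s [t [sS tT ->]]] := MST y.
  by exists (Submodule sS); rewrite /= addrC addKr.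
- rewrite sub0r => Ty; apply: val_inj; rewrite linear0; apply: ST.
    exact: valP.
  by rewrite -[\val y]opprK -scaleN1r rpredZ.
- by rewrite !linearP /= addrACA -scalerDr rpredD ?rpredZ.
pose x' : submodule_of S := Submodule xS.
have px : p x = x'.
  apply/eqP; rewrite -subr_eq0 -oppr_eq0 opprB; apply/eqP/val_inj.
  rewrite [in RHS]linear0; apply: ST; first exact: valP.
  by rewrite linearB; apply: pT.
have [x'0|/(projective_torsionless Sproj)[f /eqP[]]] := eqVneq x' 0.
  by rewrite -[x]/(\val x') x'0 linear0.
by rewrite -px; apply: (f0 (f \o p)).
Qed.

Lemma stable_quotient M N (q : {linear M -> N}) : left_hereditary R ->
  (forall y, exists x, q x = y) -> stable M -> stable N.
Proof.
move=> hR qS Mst; apply: hom0_stable => f y; have [x <-] := qS y.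
exact: (stable_hom0 (f \o q)).
Qed.

Lemma stable_prod M N : left_hereditary R ->
  stable M -> stable N -> stable (M * N : lmodType R)%type.
Proof.
move=> hR Mst Nst; apply: hom0_stable => f [x y].
have [|f1 f1E] := @linear_exists R M R^o (fun x => f (x, 0)).
  by move=> a u v; rewrite -linearP; congr (f (_, _)); rewrite /= scaler0 addr0.
have [|f2 f2E] := @linear_exists R N R^o (fun y => f (0, y)).
  by move=> a u v; rewrite -linearP; congr (f (_, _)); rewrite /= scaler0 addr0.
have -> : (x, y) = (x, 0) + (0, y) :> (M * N)%type.
  by congr (_, _); rewrite /= ?addr0 ?add0r.
by rewrite linearD -f1E -f2E !stable_hom0 // addr0.
Qed.

Lemma stable_essential M N (i : {linear M -> N}) : left_hereditary R ->
  stable M -> essential_extension i -> stable N.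
Proof.
move=> hR Mst [iI iess]; apply: hom0_stable => f x.
have [I [g [gS gE]]] := linear_image f.
have [h hE] := hR I _ _ g idfun gS.
(* [S] is a complement of the kernel of [f]. If [i x = h z], then [z = g (i x)] vanishes because
   [f \o i] is a functional on the stable module [M]; essentiality then leaves no nonzero element in
   [S]. *)
have [S SP] := image_submod h.
rewrite -gE; have [->|hgx] := eqVneq (g x) 0; first exact: linear0.
have [|y /SP[z zE]] := iess S.
  exists (h (g x)); first by apply/SP; exists (g x).
  by apply: contra_neq hgx => hgx; rewrite -[g x]/(idfun (g x)) -hE hgx linear0.
case/eqP; rewrite -zE (_ : z = 0) ?linear0 //; apply: val_inj.
by rewrite -[z]/(idfun z) -hE zE gE linear0; apply: (stable_hom0 (f \o i)).
Qed.

(** A functional on [M], seen as a map to [E], extends to [g] on [N]. A nonzero value of [g] would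
    be detected by a functional [c] on the projective module [E], and [c \o g] would contradict
    stability of [N]. *)
Lemma stable_sub M N (k : {linear M -> N}) : hereditary_QF3plus R ->
  injective k -> stable N -> stable M.
Proof.
move=> [hR [E [i [[[iI _] Einj] Eproj]]]] kI Nst; apply: hom0_stable => f x.
have [g gE] := Einj _ _ k (i \o f) kI.
apply: (linear_inj0 iI); rewrite -[i _]/((i \o f) x) -gE.
have [//|/(projective_torsionless Eproj)[c /eqP[]]] := eqVneq (g (k x)) 0.
exact: (stable_hom0 (c \o g)).
Qed.

End StableModules.

(** * The category of stable modules *)

Section StableCategory.
Variable R : pzRingType.
Hypothesis hR : hereditary_QF3plus R.
Local Notation C := (stable_category R).

Definition stable_obj (M : lmodType R) (Mst : stable M) : obj C := exist _ M Mst.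

(** The module kernel is stable, being a submodule of [A]. Exactness is phrased on elements, a form
    that also serves for normality of monics and epics. *)
Lemma stable_kernel (A B : obj C) (f : mor A B) :
  exists (K : obj C) (k : mor K A),
    injective k /\ forall x, f x = 0 <-> exists z, k z = x.
Proof.
have [S SP] := ker_submod f.
pose v : {linear submodule_of S -> sval A} := \val.
have vI : injective v by apply: val_inj.
exists (stable_obj (stable_sub hR vI (proj2_sig A))), v; split=> // x.
split=> [/SP xS|[z <-]]; first by exists (Submodule xS).
exact/SP/valP.
Qed.

Lemma stable_cokernel (A B : obj C) (f : mor A B) :
  exists (Q : obj C) (q : mor B Q),
    (forall y, exists x, q x = y) /\ forall x, q x = 0 <-> exists z, f z = x.
Proof.
have [S SP] := image_submod f.
have [Q [q [qS qP]]] := quotient_exists S.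
exists (stable_obj (stable_quotient hR.1 qS (proj2_sig B))), q; split=> // x.
exact: iff_trans (qP x) (SP x).
Qed.

Lemma mor_ext (A B : obj C) (f g : mor A B) : f =1 g -> f = g.
Proof. exact: linear_ext. Qed.

(** A monic [f] cannot distinguish the inclusion of its kernel from 0; this test is possible inside
    [C] because the kernel is stable. *)
Lemma monicP (A B : obj C) (f : mor A B) : Defs.monic f <-> injective f.
Proof.
split=> [fm|fI X g h fgh]; last first.
  by apply: mor_ext => x; apply: fI; apply: (congr1 (fun u : mor X B => u x) fgh).
apply: linear_inj => x fx.
have [K [k [_ kP]]] := stable_kernel f.
have /kP[z <-] := fx.
rewrite (fm K k 0) //; apply: mor_ext => y /=.
by rewrite linear0; apply/kP; exists y.
Qed.

Lemma epicP (A B : obj C) (f : mor A B) :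
  epic f <-> forall y, exists x, f x = y.
Proof.
split=> [fe y|fS X g h gfh]; last first.
  apply: mor_ext => y; have [x <-] := fS y.
  exact: (congr1 (fun u : mor A X => u x) gfh).
have [Q [q [_ qP]]] := stable_cokernel f.
apply/qP; rewrite (fe Q q 0) //; apply: mor_ext => x /=.
by apply/qP; exists x.
Qed.

(** Used twice: for kernels of arbitrary maps, and to exhibit a monic as the kernel of its
    cokernel. *)
Lemma is_kernel_exact (A B K : obj C) (f : mor A B) (k : mor K A) :
  injective k -> (forall x, f x = 0 <-> exists z, k z = x) -> is_kernel f k.
Proof.
move=> kI kP; split=> [|X g fg0].
  by apply: mor_ext => z; apply/kP; exists z.
have [x|h hE] := @linear_lift _ _ _ _ k g kI.
  by apply/kP; apply: (congr1 (fun u : mor X B => u x) fg0).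
exists h; split=> [|h' h'E]; apply: mor_ext => x; first exact: hE.
by apply: kI; rewrite hE -h'E.
Qed.

Lemma is_cokernel_exact (A B Q : obj C) (f : mor A B) (q : mor B Q) :
  (forall y, exists x, q x = y) -> (forall x, q x = 0 <-> exists z, f z = x) ->
  is_cokernel f q.
Proof.
move=> qS qP; split=> [|X g gf0].
  by apply: mor_ext => z; apply/qP; exists z.
have [x /qP[z <-]|h hE] := @linear_factor _ _ _ _ q g qS.
  exact: (congr1 (fun u : mor A X => u z) gf0).
exists h; split=> [|h' h'E]; apply: mor_ext => x; first exact: hE.
by have [y <-] := qS x; rewrite hE -h'E.
Qed.

Lemma stable_additive : additive_category C.
Proof.
split.
  (* The zero object is realised as the zero submodule of [R]. *)
  have [|S SP] := @submod_of_set R R^o [set 0].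
    by split=> // a _ _ -> ->; rewrite /= scaler0 addr0.
  have S0 (x : submodule_of S) : x = 0.
    by apply: val_inj; apply/SP/valP.
  have Zst : stable (submodule_of S) by move=> T _ _ x _; apply: S0.
  exists (stable_obj Zst) => X; split=> f; apply: mor_ext => x /=.
    by rewrite (S0 x) linear0.
  exact: S0.
move=> [M Mst] [N Nst].
have [|i1 i1E] := @linear_exists R M (M * N)%type (fun x => (x, 0)).
  by move=> a u v; congr (_, _); rewrite /= scaler0 addr0.
have [|i2 i2E] := @linear_exists R N (M * N)%type (fun y => (0, y)).
  by move=> a u v; congr (_, _); rewrite /= scaler0 addr0.
pose p1 : {linear (M * N)%type -> M} := fst.
pose p2 : {linear (M * N)%type -> N} := snd.
exists (stable_obj (stable_prod hR.1 Mst Nst)), i1, i2, p1, p2.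
split; apply: linear_ext => x /=; rewrite ?i1E ?i2E //.
by case: x => x y; congr (_, _); rewrite /= ?addr0 ?add0r.
Qed.

Lemma stable_abelian : abelian_category C.
Proof.
split; first exact: stable_additive.
- move=> A B f; have [K [k [kI kP]]] := stable_kernel f.
  by exists K, k; apply: is_kernel_exact.
- move=> A B f; have [Q [q [qS qP]]] := stable_cokernel f.
  by exists Q, q; apply: is_cokernel_exact.
- move=> A B f /monicP fI; have [Q [q [_ qP]]] := stable_cokernel f.
  by exists Q, q; apply: is_kernel_exact.
- move=> A B f /epicP fS; have [K [k [_ kP]]] := stable_kernel f.
  by exists K, k; apply: is_cokernel_exact.
Qed.

(** The envelope in modules is stable, as an essential extension. Monics of [C] are injective maps,
    so its injectivity carries over to [C]. *)
Lemma stable_has_injective_envelopes : has_injective_envelopes C.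
Proof.
move=> [M Mst]; have [E [i [iess Einj]]] := injective_envelope_exists M hR.
exists (stable_obj (stable_essential hR.1 Mst iess)), i; split; last first.
  move=> A B g f /monicP gI; have [h hE] := Einj _ _ g f gI.
  by exists h; apply: linear_ext.
have [iI iE] := iess; split=> [|X g /monicP giI]; first exact/monicP.
apply/monicP; apply: linear_inj => y gy.
(* As [g \o i] is injective, the kernel of [g] meets the image of [i] trivially, so it is zero by
   essentiality. *)
have [S SP] := ker_submod g.
have [//|y0] := eqVneq y 0.
have [|x /SP gix] := iE S; first by exists y => //; apply/SP.
case/eqP; rewrite (_ : x = 0) ?linear0 //.
exact: (linear_inj0 giI).
Qed.

End StableCategory.

Theorem corollary3p4 (R : pzRingType) :
  hereditary_QF3plus R ->
  [/\ abelian_category (stable_category R),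
      (forall (M N : lmodType R) (i : {linear M -> N}),
         stable M -> essential_extension i -> stable N),
      (forall (M E : lmodType R) (i : {linear M -> E}),
         stable M -> injective_envelope i -> stable E)
    & has_injective_envelopes (stable_category R)].
Proof.
move=> hR; split.
- exact: stable_abelian.
- by move=> M N i; apply: stable_essential hR.1.
- by move=> M E i Mst [iess _]; apply: stable_essential hR.1 Mst iess.
- exact: stable_has_injective_envelopes.
Qed.
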